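(* Let $\lambda>0$ and $\theta\in(0,1)$, let $H_N=\sum_{j=1}^N\frac1j$, and consider for each $N\in\mathbb{N}$ the harmonic aligned Zipf model $p_i=w_i=\frac{1}{iH_N}$, $1\le i\le N$, with quorum time $\tau^{(1)}_{N,\theta}$. Define \[ c_\theta:=e^{(\theta-2)\gamma}, \] where $\gamma$ is Euler's constant. Then \[ \frac{\tau^{(1)}_{N,\theta}}{H_NN^\theta}\longrightarrow\frac{c_\theta}{\lambda}\quad\text{in probability as }N\to\infty. \]
   Context: For each $N$, let $T_1,\dots,T_N$ (depending on $N$) be independent with $T_i\sim\mathrm{Exp}(\lambda p_i)$ (rate $\lambda p_i$). Discovered-mass process: $M^{(1)}_N(t)=\sum_{i=1}^N w_i\mathbf{1}_{\{T_i\le t\}}$. Quorum time: $\tau^{(1)}_{N,\theta}=\inf\{t\ge0:M^{(1)}_N(t)>\theta\}$. *)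

(* Defs.v *)
From HB Require Import structures.
From mathcomp Require Import all_boot all_order all_algebra.
From mathcomp Require Import all_classical all_reals all_analysis.
Import Order.TTheory GRing.Theory Num.Theory.
Import numFieldNormedType.Exports.

Set Implicit Arguments.
Unset Strict Implicit.
Unset Printing Implicit Defensive.

Local Open Scope classical_set_scope.
Local Open Scope ring_scope.

(* Mutual independence: the product rule over every subfamily [J]. *)
Definition independent_RVs (R : realType) (d : measure_display)
    (Omega : measurableType d) (P : probability Omega R) (I : finType)
    (X : I -> {RV P >-> R}) : Prop :=
  forall (J : {set I}) (A : I -> set R),
    (forall i, i \in J -> measurable (A i)) ->
    P (\bigcap_(i in [set` J]) (X i @^-1` A i))
    = (\prod_(i in J) P (X i @^-1` A i))%E.

Definition exponentially_distributed (R : realType) (d : measure_display)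
    (Omega : measurableType d) (P : probability Omega R)
    (X : {RV P >-> R}) (rate : R) : Prop :=
  forall A : set R, measurable A ->
    distribution P X A = exponential_prob rate A.

(* [X N] may live on a different probability space for each [N]. The values
   are extended reals because a hitting time can be infinite. *)
Definition cvg_in_probability (R : realType) (d : nat -> measure_display)
    (Omega : forall N, measurableType (d N))
    (P : forall N, probability (Omega N) R)
    (X : forall N, Omega N -> \bar R) (l : R) : Prop :=
  forall eps : R, 0 < eps ->
    P N [set omega | (eps%:E < `|X N omega - l%:E|)%E] @[N --> \oo] --> 0%E.

Definition discovered_mass (R : realType) (Omega : Type) (N : nat)
    (w : 'I_N -> R) (T : 'I_N -> Omega -> R) (t : R) (omega : Omega) : R :=
  \sum_(i < N) w i * \1_[set omega' | T i omega' <= t] omega.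

Definition quorum_time (R : realType) (Omega : Type) (N : nat)
    (w : 'I_N -> R) (T : 'I_N -> Omega -> R) (theta : R)
    (omega : Omega) : \bar R :=
  ereal_inf [set t%:E |
    t in [set t : R | 0 <= t /\ theta < discovered_mass w T t omega]].

Definition harmonic_number (R : realType) (N : nat) : R :=
  \sum_(1 <= j < N.+1) j%:R^-1.

(* Ordinals start at 0, so [i : 'I_N] stands for the rank [i.+1]. *)
Definition zipf (R : realType) (N : nat) (i : 'I_N) : R :=
  (i.+1%:R * harmonic_number R N)^-1.

Definition euler_gamma (R : realType) : R :=
  limn (fun n : nat => harmonic_number R n - ln n%:R).

Definition c_ (R : realType) (theta : R) : R :=
  expR ((theta - 2) * euler_gamma R).

(* Main.v *)
(** At time [t = x H_N N^theta / lambda] the mean of [H_N M_N(t)] is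
    [S_N(a) = sum_(i <= N) (1 - e^(-a/i)) / i] with [a = x N^theta], and its
    variance is at most [sum_i e^(-a/i) / i^2], which tends to 0. Since
    [S_N(a) = ln a + 2 gamma + o(1)] while
    [theta H_N = theta ln N + theta gamma + o(1)], Chebyshev's inequality shows
    that the quorum is reached before [t] with probability tending to 1 or to 0
    according to the sign of [ln x + (2 - theta) gamma], that is, of
    [x - c_theta].

    For the asymptotics of [S_N], [e^(-n/i)] lies between [(1 - 1/i)^n] and
    [(1 - 1/(i+1))^n], so that one can use
    [sum_(i <= N) (1 - (1 - 1/i)^n) / i] instead. With
    [L_n(y) = sum_(k <= n) y^k / k], its [i]-th term differs from
    [L_n(1 - 1/(i+1)) - L_n(1 - 1/i)] by an amount between 0 and [1/(i(i+1))]
    whose limit as [n -> oo] is [1/i - ln (1 + 1/i)]. By dominated convergence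
    these differences add up to [gamma], while the telescoping part is
    [H_n + o(1) = ln n + gamma + o(1)]. *)

Require Import Defs.
From HB Require Import structures.
From mathcomp Require Import all_boot all_order all_algebra.
From mathcomp Require Import all_classical all_reals all_analysis measurable_realfun.
From mathcomp Require Import ring lra.
Import Order.TTheory GRing.Theory Num.Theory.
Import numFieldNormedType.Exports.

Set Implicit Arguments.
Unset Strict Implicit.
Unset Printing Implicit Defensive.

Local Open Scope classical_set_scope.
Local Open Scope ring_scope.

Lemma cvgn_congr {R : realType} {f g : nat -> R} {l l' : R} :
  f =1 g -> g @ \oo --> l -> l = l' -> f @ \oo --> l'.
Proof. by move=> /funext -> + <-. Qed.

Lemma cvgn_subseq {R : realType} {n : nat -> nat} {g : nat -> R} {l : R} :
  n N @[N --> \oo] --> \oo -> g @ \oo --> l -> (fun N => g (n N)) @ \oo --> l.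
Proof. by move=> h hg; exact: cvg_comp h hg. Qed.

(** * Dominated convergence of sums and Euler's constant *)

Section tannery.
Context {R : realType}.
Implicit Types (f : nat -> nat -> R) (g l : nat -> R).

(** Tannery's theorem, with the number of terms growing along with the parameter. Beyond a fixed [K]
    each term is at most [2 * g i], so the tail is uniformly small, and the head is a finite sum of
    null sequences. *)
Lemma tannery f g l :
  (forall N i, `|f N i| <= g i) -> cvgn (series g) ->
  (forall i, f N i @[N --> \oo] --> l i) ->
  \sum_(0 <= i < N) (f N i - l i) @[N --> \oo] --> 0.
Proof.
move=> fg cg fl.
have g0 i : 0 <= g i by exact: le_trans (fg 0 i).
have lg i : `|l i| <= g i.
  rewrite -(cvg_lim _ (cvg_norm (fl i)))//.
  apply: limr_le; first by apply/cvg_ex; exists `|l i|; exact: cvg_norm (fl i).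
  by apply: nearW => N; exact: fg.
have ng : {homo series g : m n / (m <= n)%N >-> m <= n}.
  by apply/nondecreasing_seqP => n; rewrite seriesEnat/= big_nat_recr//= lerDl.
apply/cvgr0Pnorm_le => e e0.
(* The tail of [g] enters twice, once for [f N i] and once for [l i], so [e / 4] leaves [e / 2] for
   the head. *)
have e4 : 0 < e / 4 by rewrite divr_gt0.
have /cvgrPdist_le /(_ _ e4) [K _ /(_ K (leqnn K))] := cg.
rewrite ger0_norm ?subr_ge0; last exact: nondecreasing_cvgn_le.
move=> hK.
have : \sum_(0 <= i < K) `|f N i - l i| @[N --> \oo] --> 0.
  rewrite [X in _ --> X](_ : 0 = \sum_(0 <= i < K) (0 : R)); last by rewrite big1.
  apply: cvg_big => [|i _]; first exact: add_continuous.
  rewrite -(normr0 R) -(subrr (l i)); apply: cvg_norm.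
  by apply: cvgB; [exact: fl|exact: cvg_cst].
move=> /cvgr0Pnorm_le /(_ (e / 2)).
have e2 : 0 < e / 2 by rewrite divr_gt0.
move=> /(_ e2) hf.
near=> N.
have KN : (K <= N)%N by near: N; exact: nbhs_infty_ge.
rewrite (@big_cat_nat _ _ _ K)//=.
rewrite (splitr e); apply: le_trans (ler_normD _ _) _; apply: lerD.
  apply: le_trans (ler_norm_sum _ _ _) _.
  by apply: le_trans (ler_norm _) _; near: N; exact: hf.
apply: le_trans (ler_norm_sum _ _ _) _.
apply: (@le_trans _ _ (\sum_(K <= i < N) (g i *+ 2))).
  apply: ler_sum => i _; apply: le_trans (ler_normB _ _) _.
  by rewrite mulr2n lerD.
rewrite sumrMnl.
have -> : \sum_(K <= i < N) g i = series g N - series g K.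
  by rewrite sub_series_geq.
have := nondecreasing_cvgn_le ng cg N.
rewrite mulr2n; lra.
Unshelve. all: by end_near. Qed.

End tannery.

Section euler_constant.
Context {R : realType}.
Local Notation u := (@harmonic R).
Local Notation H := (harmonic_number R).

Lemma harmonic_subS i : u i - u i.+1 = u i * u i.+1.
Proof.
rewrite /harmonic/= -[i.+2%:R]natr1.
have : (i.+1%:R : R) > 0 by []; move: (i.+1%:R : R) => x x0.
by field; rewrite !gt_eqF// addr_gt0.
Qed.

Lemma series_harmonicMS N : \sum_(0 <= i < N) (u i * u i.+1) = 1 - u N.
Proof.
under eq_bigr do rewrite -harmonic_subS -opprB.
by rewrite sumrN telescope_sumr// opprB /harmonic/= invr1.
Qed.

(** This telescoping series supplies the dominating sequence in every use of [tannery] below, up to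
    a factor 2 for the variance. *)
Lemma cvg_series_harmonicMS : cvgn (series (fun i => u i * u i.+1)).
Proof.
apply/cvg_ex; exists 1.
rewrite [X in X @ _ --> _](_ : _ = (fun N => 1 - u N)).
  by rewrite -[X in _ --> X]subr0; apply: cvgB; [exact: cvg_cst|exact: cvg_harmonic].
by apply/funext => N; rewrite seriesEnat/= series_harmonicMS.
Qed.

Lemma harmonic_numberE N : H N = \sum_(0 <= i < N) u i.
Proof. by rewrite /harmonic_number big_add1. Qed.

(** Both bounds are [ln (1 + z) <= z], taken at [z = u i] and at [z = - u i.+1], because [1 + u i]
    is the inverse of [1 - u i.+1]. *)
Lemma harmonic_sub_ln_bounds i : 0 <= u i - ln (1 + u i) <= u i * u i.+1.
Proof.
have u0 := @harmonic_gt0 R i.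
apply/andP; split; first by rewrite subr_ge0 le_ln1Dx// (lt_trans _ u0)// oppr_lt0.
rewrite -harmonic_subS lerD2l lerN2.
have -> : 1 + u i = (1 - u i.+1)^-1.
  rewrite /harmonic/= -[i.+2%:R]natr1.
  have : (i.+1%:R : R) > 0 by []; move: (i.+1%:R : R) => x x0.
  by field; rewrite [x + 1]addrC addrAC subrr add0r !gt_eqF// addr_gt0.
have u1 : 0 < 1 - u i.+1 by rewrite subr_gt0 /harmonic/= invf_lt1 ?ltr1n.
rewrite lnV ?posrE// lerNr.
by apply: le_ln1Dx; rewrite ltrN2 -subr_gt0.
Qed.

Lemma ln_prodS N : \sum_(0 <= i < N) ln (1 + u i) = ln N.+1%:R.
Proof.
have := @telescope_sumr R 0 N (fun i => ln i.+1%:R) (leq0n N).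
rewrite ln1 subr0 => <-.
apply: eq_bigr => i _; rewrite -ln_div ?posrE//; congr ln.
by rewrite /harmonic/= -[i.+2%:R]natr1 mulrDl divff// mul1r.
Qed.

Lemma cvg_ln_ratioS : ln N.+1%:R - ln N%:R @[N --> \oo] --> (0 : R).
Proof.
(* The shift removes the index 0, where [ln 0] is a default value. *)
rewrite -cvg_shiftS.
have : ln (1 + u N) @[N --> \oo] --> ln (1 + 0 : R).
  apply: continuous_cvg; first by rewrite addr0; exact: continuous_ln.
  by apply: cvgD; [exact: cvg_cst|exact: cvg_harmonic].
rewrite addr0 ln1.
suff -> : (fun N => ln (1 + u N)) = (fun N => ln N.+2%:R - ln N.+1%:R) by exact.
apply/funext => N; rewrite -ln_div ?posrE//; congr ln.
by rewrite /harmonic/= -[N.+2%:R]natr1 mulrDl divff// mul1r.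
Qed.

(** As [euler_gamma] is defined by [limn], only the existence of the limit is at stake. It comes
    from comparing the series of [u i - ln (1 + u i)], whose partial sums are [H N - ln N.+1%:R],
    with the telescoping series. *)
Lemma cvg_harmonic_sub_ln :
  H N - ln N%:R @[N --> \oo] --> euler_gamma R.
Proof.
suff h : cvgn (fun N => H N - ln N%:R) by exact: h.
have h1 : cvgn (series (fun i => u i - ln (1 + u i))).
  apply: (series_le_cvg _ _ _ cvg_series_harmonicMS) => i.
  - by have /andP[] := harmonic_sub_ln_bounds i.
  - by rewrite mulr_ge0// harmonic_ge0.
  - by have /andP[] := harmonic_sub_ln_bounds i.
have -> : (fun N => H N - ln N%:R) =
    (fun N => series (fun i => u i - ln (1 + u i)) N + (ln N.+1%:R - ln N%:R)).
  apply/funext => N; rewrite seriesEnat/= sumrB -harmonic_numberE ln_prodS.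
  by rewrite addrA subrK.
by apply: is_cvgD => //; apply/cvg_ex; exists 0; exact: cvg_ln_ratioS.
Qed.

Lemma cvg_series_harmonic_sub_ln :
  \sum_(0 <= i < N) (u i - ln (1 + u i)) @[N --> \oo] --> euler_gamma R.
Proof.
rewrite [X in X @ _ --> _](_ : _ =
    (fun N => H N - ln N%:R - (ln N.+1%:R - ln N%:R))); last first.
  apply/funext => N; rewrite sumrB -harmonic_numberE ln_prodS.
  by rewrite opprB addrA subrK.
rewrite -[X in _ --> X]subr0.
by apply: cvgB; [exact: cvg_harmonic_sub_ln|exact: cvg_ln_ratioS].
Qed.

End euler_constant.

(** * The series of the logarithm *)

Section mercator.
Context {R : realType}.
Local Notation u := (@harmonic R).

(** Partial sum of the Mercator series of [- ln (1 - y)], the [L_n] of the overview with its index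
    shifted by one. *)
Definition mercator n (y : R) := \sum_(0 <= k < n) u k * y ^+ k.+1.

Lemma geometric_sum (y : R) n :
  (1 - y) * \sum_(0 <= k < n) y ^+ k = 1 - y ^+ n.
Proof. by rewrite big_mkord -[1 - y]opprB mulNr -subrX1 opprB. Qed.

Lemma is_derive_mercator n (x : R) :
  is_derive x (1 : R) (mercator n) (\sum_(0 <= k < n) x ^+ k).
Proof.
elim: n => [|n ih].
  rewrite big_nil (_ : mercator 0 = cst 0); first exact: is_derive_cst.
  by apply/funext => y; rewrite /mercator big_nil.
rewrite big_nat_recr//= (_ : mercator n.+1 =
    mercator n + (fun y => u n * y ^+ n.+1)); last first.
  by apply/funext => y; rewrite /mercator big_nat_recr.
apply: is_deriveD.
have -> : (fun y => u n * y ^+ n.+1) = u n *: (@idfun R ^+ n.+1).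
  by apply/funext => y; rewrite /= exprfctE.
apply: is_derive_eq; rewrite /= -mulr_natl.
by rewrite /GRing.scale/= !mulr1 mulrA mulVf// mul1r.
Qed.

(** The middle expression vanishes at 0 and has derivative [- x^n / (1 - x)] by the geometric sum.
    The mean value theorem gives that derivative at some [c] in [[0, y]], times a factor
    [y <= 1]. *)
Lemma mercator_bounds n (y : R) : 0 <= y -> y < 1 ->
  - (y ^+ n * (1 - y)^-1) <= mercator n y + ln (1 - y) <= 0.
Proof.
move=> y0 y1.
pose f (x : R) := mercator n x + ln (1 - x).
pose df (x : R) := - (x ^+ n * (1 - x)^-1).
have df1 (x : R) : 0 <= x <= y -> is_derive x (1 : R) f (df x).
  move=> /andP[x0 xy].
  have x1 : 0 < 1 - x by rewrite subr_gt0 (le_lt_trans xy).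
  have := is_derive_mercator n x => h1.
  have := is_derive1_ln x1 => h2.
  have h3 : is_derive x (1 : R) (@ln R \o (fun z => 1 - z)) (- (1 - x)^-1).
    have h4 : is_derive x (1 : R) (fun z : R => 1 - z) (-1).
      have := is_deriveB (is_derive_cst (1 : R) x 1) (is_derive_id x (1 : R)).
      by rewrite sub0r.
    by have := @is_derive1_comp R (@ln R) _ x _ _ h2 h4; rewrite mulrN1.
  suff -> : df x = \sum_(0 <= k < n) x ^+ k - (1 - x)^-1 by exact: is_deriveD h1 h3.
  rewrite /df -[X in _ = X - _](mulKf (lt0r_neq0 x1)) geometric_sum.
  by rewrite mulrBr mulr1 addrAC subrr sub0r mulrC.
have [||c cy] := @MVT_segment R f df 0 y y0.
- by move=> x; rewrite in_itv/= => /andP[/ltW x0 /ltW xy]; apply: df1; rewrite x0.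
- apply: derivable_within_continuous => x; rewrite in_itv/= => xy.
  by have [] := df1 x xy.
have f0 : f 0 = 0.
  rewrite /f /mercator subr0 ln1 addr0 big1// => i _.
  by rewrite expr0n mulr0.
rewrite f0 !subr0 -/(f y) => ->.
move: cy; rewrite in_itv/= => /andP[c0 cy].
have c1 : 0 < 1 - c by rewrite subr_gt0 (le_lt_trans cy).
rewrite /df mulNr lerN2 oppr_le0; apply/andP; split; last first.
  by rewrite !mulr_ge0// ?exprn_ge0// invr_ge0 ltW.
rewrite -[leRHS]mulr1 ler_pM ?(ltW y1)//.
  by rewrite mulr_ge0 ?exprn_ge0// invr_ge0 ltW.
rewrite ler_pM ?exprn_ge0 ?invr_ge0 ?(ltW c1)//; first exact: lerXn2r.
by rewrite lef_pV2 ?posrE; lra.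
Qed.

Lemma cvg_mercator (y : R) : 0 <= y -> y < 1 ->
  mercator n y @[n --> \oo] --> - ln (1 - y).
Proof.
move=> y0 y1.
have : mercator n y + ln (1 - y) @[n --> \oo] --> (0 : R).
  apply: squeeze_cvgr; first by apply: nearW => n; exact: mercator_bounds.
    rewrite -oppr0 -(mul0r (1 - y)^-1); apply: cvgN.
    by apply: cvgMl; apply: cvg_expr; rewrite ger0_norm.
  exact: cvg_cst.
move=> h; apply: (cvgn_congr _ (cvgB h (cvg_cst (ln (1 - y))))).
  by move=> n; rewrite addrK.
by rewrite sub0r.
Qed.

End mercator.

(** * Asymptotics of the expected mass *)

Section expected_mass.
Context {R : realType}.
Local Notation u := (@harmonic R).
Local Notation H := (harmonic_number R).
Local Notation mercator := (@mercator R).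

(* Since [harmonic i = 1/(i+1)], the rank [i+1] of the model carries index [i]. *)
Definition geometric_mass N n := \sum_(0 <= i < N) u i * (1 - (1 - u i) ^+ n).

Definition expected_mass N (a : R) :=
  \sum_(0 <= i < N) u i * (1 - expR (- (a * u i))).

Lemma harmonic_le1 i : u i <= 1.
Proof. by rewrite /harmonic/= invf_le1 ?ler1n. Qed.

Lemma harmonicS_le i : u i.+1 <= u i.
Proof. by rewrite /harmonic/= lef_pV2 ?posrE// ler_nat. Qed.

(** Mean value bounds for a power, by induction from [y^(n+2) - x^(n+2) = y (y^(n+1) - x^(n+1)) +
    x^(n+1) (y - x)]. The lower bound weakens the factor [y] to [x], the upper one [x^(n+1)] to
    [y^(n+1)]. *)
Lemma ler_expB n (x y : R) : 0 <= x -> x <= y ->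
  n.+1%:R * x ^+ n * (y - x) <= y ^+ n.+1 - x ^+ n.+1 <=
  n.+1%:R * y ^+ n * (y - x).
Proof.
move=> x0 xy; have y0 := le_trans x0 xy.
elim: n => [|n /andP[ih1 ih2]]; first by rewrite !expr0 !expr1 !mul1r lexx.
have yx0 : 0 <= y - x by rewrite subr_ge0.
have nxy : x ^+ n.+1 <= y ^+ n.+1 by rewrite lerXn2r.
have -> : y ^+ n.+2 - x ^+ n.+2 =
    y * (y ^+ n.+1 - x ^+ n.+1) + x ^+ n.+1 * (y - x).
  by rewrite [y ^+ n.+2]exprS [x ^+ n.+2]exprS; ring.
have e1 : n.+2%:R * x ^+ n.+1 * (y - x) =
    x * (n.+1%:R * x ^+ n * (y - x)) + x ^+ n.+1 * (y - x).
  by rewrite -[n.+2%:R]natr1 exprS; ring.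
have e2 : n.+2%:R * y ^+ n.+1 * (y - x) =
    y * (n.+1%:R * y ^+ n * (y - x)) + y ^+ n.+1 * (y - x).
  by rewrite -[n.+2%:R]natr1 [y ^+ n.+1]exprS; ring.
rewrite e1 e2; apply/andP; split; last by rewrite lerD// ?ler_wpM2l// ler_wpM2r.
rewrite lerD2r; apply: le_trans (ler_wpM2l x0 ih1) _.
by rewrite ler_wpM2r// subr_ge0.
Qed.

Lemma mercatorB_bounds n (x y : R) : 0 <= x -> x <= y ->
  (y - x) * \sum_(0 <= k < n) x ^+ k <= mercator n y - mercator n x <=
  (y - x) * \sum_(0 <= k < n) y ^+ k.
Proof.
move=> x0 xy; rewrite /mercator -sumrB !mulr_sumr.
apply/andP; split; apply: ler_sum => k _; rewrite -mulrBr.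
- have /andP[h _] := ler_expB k x0 xy.
  by rewrite /harmonic/= ler_pdivlMl// [(y - x) * _]mulrC mulrA.
- have /andP[_ h] := ler_expB k x0 xy.
  by rewrite /harmonic/= ler_pdivrMl// [(y - x) * _]mulrC mulrA.
Qed.

Definition mass_increment n i :=
  u i * (1 - (1 - u i) ^+ n) - (mercator n (1 - u i.+1) - mercator n (1 - u i)).

(** The points [1 - u i] and [1 - u i.+1] are [u i * u i.+1] apart, so summing the geometric series
    in [mercatorB_bounds] places the difference of [mercator] between [u i.+1 * (1 - (1 - u i)^n)]
    and [u i * (1 - (1 - u i.+1)^n)]. *)
Lemma mass_increment_bounds n i : 0 <= mass_increment n i <= u i * u i.+1.
Proof.
have x0 : 0 <= 1 - u i by rewrite subr_ge0 harmonic_le1.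
have xy : 1 - u i <= 1 - u i.+1 by rewrite lerD2l lerN2 harmonicS_le.
have y1 : 1 - u i.+1 <= 1 by rewrite gerBl harmonic_ge0.
have /andP[] := mercatorB_bounds n x0 xy.
have -> : 1 - u i.+1 - (1 - u i) = u i * u i.+1 by rewrite -harmonic_subS; ring.
have g1 := geometric_sum (1 - u i) n; rewrite subKr in g1.
have g2 := geometric_sum (1 - u i.+1) n; rewrite subKr in g2.
rewrite [u i * u i.+1]mulrC -{1}mulrA g1 [u i.+1 * u i]mulrC -mulrA g2 => h1 h2.
have hn : (1 - u i) ^+ n <= (1 - u i.+1) ^+ n by rewrite lerXn2r ?nnegrE// (le_trans x0).
have hn0 : 0 <= (1 - u i) ^+ n by rewrite exprn_ge0.
rewrite /mass_increment subr_ge0; apply/andP; split.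
  by apply: le_trans h2 _; rewrite ler_wpM2l ?harmonic_ge0// lerD2l lerN2.
apply: (@le_trans _ _ ((u i - u i.+1) * (1 - (1 - u i) ^+ n))).
  by rewrite mulrBl lerD2l lerN2.
rewrite harmonic_subS -[leRHS]mulr1 ler_wpM2l ?mulr_ge0 ?harmonic_ge0//.
by rewrite gerBl.
Qed.

(** The two values of [mercator] tend to [- ln (u i.+1)] and [- ln (u i)], and
    [u i / u i.+1 = 1 + u i]. *)
Lemma cvg_mass_increment i :
  mass_increment n i @[n --> \oo] --> u i - ln (1 + u i).
Proof.
have x0 : 0 <= 1 - u i by rewrite subr_ge0 harmonic_le1.
have x1 : 1 - u i < 1 by rewrite gtrBl harmonic_gt0.
have y0 : 0 <= 1 - u i.+1 by rewrite subr_ge0 harmonic_le1.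
have y1 : 1 - u i.+1 < 1 by rewrite gtrBl harmonic_gt0.
have hx := cvg_mercator x0 x1; have hy := cvg_mercator y0 y1.
have hX : (1 - u i) ^+ n @[n --> \oo] --> (0 : R).
  by apply: cvg_expr; rewrite ger0_norm.
apply: (cvgn_congr _
  (cvgB (cvgM (cvg_cst (u i)) (cvgB (cvg_cst (1 : R)) hX)) (cvgB hy hx))) => //.
rewrite subr0 mulr1 !subKr opprK; congr (_ - _).
have -> : 1 + u i = u i / u i.+1.
  by rewrite /harmonic/= invrK -[i.+2%:R]natr1 mulrDr mulVf// mulr1 addrC.
by rewrite ln_div ?posrE ?harmonic_gt0// addrC.
Qed.

Lemma geometric_massE N n :
  geometric_mass N n = \sum_(0 <= i < N) mass_increment n i + mercator n (1 - u N).
Proof.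
rewrite /mass_increment [in RHS]sumrB.
rewrite (@telescope_sumr _ 0 N (fun i => mercator n (1 - u i)))//.
have -> : mercator n (1 - u 0%N) = 0.
  rewrite /mercator /harmonic/= invr1 subrr big1// => i _.
  by rewrite expr0n mulr0.
by rewrite subr0 subrK.
Qed.

(** [H n] is [mercator n 1]. By Bernoulli's inequality, moving from 1 to [1 - u N] costs at most
    [u N] in each of the [n] terms. *)
Lemma harmonic_sub_mercator N n : 0 <= H n - mercator n (1 - u N) <= n%:R * u N.
Proof.
rewrite harmonic_numberE /mercator -sumrB; apply/andP; split.
  apply: sumr_ge0 => i _; rewrite -[X in X - _]mulr1 -mulrBr mulr_ge0 ?harmonic_ge0//.
  by rewrite subr_ge0 exprn_ile1 ?subr_ge0 ?harmonic_le1// gerBl harmonic_ge0.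
rewrite mulr_natl -[X in _ *+ X]subn0 -sumr_const_nat; apply: ler_sum => i _.
rewrite -[X in X - _]mulr1 -mulrBr /harmonic/= ler_pdivrMl//.
have x0 : 0 <= 1 - u N by rewrite subr_ge0 harmonic_le1.
have x1 : 1 - u N <= 1 by rewrite gerBl harmonic_ge0.
by have /andP[_] := ler_expB i x0 x1; rewrite !expr1n mulr1 subKr.
Qed.

Section limit.
Variable n : nat -> nat.
Hypothesis n_infty : n N @[N --> \oo] --> \oo.
Hypothesis n_small : (n N)%:R * u N @[N --> \oo] --> (0 : R).

(** In [geometric_massE], [tannery] replaces the increments by their limits, and [n_small] replaces
    the telescoped endpoint by [H (n N)]. Each of the two pieces contributes one [euler_gamma]. *)
Lemma cvg_geometric_mass :
  geometric_mass N (n N) - ln (n N)%:R @[N --> \oo] --> 2 * euler_gamma R.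
Proof.
have h1 : \sum_(0 <= i < N) (mass_increment (n N) i - (u i - ln (1 + u i)))
    @[N --> \oo] --> (0 : R).
  apply: (tannery (f := fun N => mass_increment (n N)) _ cvg_series_harmonicMS).
  - move=> N i; have /andP[? ?] := mass_increment_bounds (n N) i.
    by rewrite ger0_norm.
  - by move=> i; exact: (cvgn_subseq (g := mass_increment^~ i) n_infty (@cvg_mass_increment i)).
have h2 := @cvg_series_harmonic_sub_ln R.
have h3 : H (n N) - mercator (n N) (1 - u N) @[N --> \oo] --> (0 : R).
  apply: squeeze_cvgr (cvg_cst _) n_small.
  by apply: nearW => N; exact: harmonic_sub_mercator.
have h4 := cvgn_subseq n_infty (@cvg_harmonic_sub_ln R).
apply: (cvgn_congr _ (cvgD (cvgB (cvgD h1 h2) h3) h4)) => [N|]; last first.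
  by rewrite add0r subr0 mulr_natl mulr2n.
by rewrite !fctE geometric_massE [X in X + _ - _ + _]sumrB; ring.
Qed.

(** A squeeze by geometric sums: [1 + z <= expR z] at [z = - u i] and [z = u i] gives
    [1 - u i <= expR (- u i) <= 1 - u i.+1], which is then raised to the power [n N]. *)
Lemma cvg_expected_mass_nat :
  expected_mass N (n N)%:R - ln (n N)%:R @[N --> \oo] --> 2 * euler_gamma R.
Proof.
have cM (x y : R) m : x <= y -> 0 <= x -> x ^+ m <= y ^+ m.
  by move=> xy x0; rewrite lerXn2r ?nnegrE// (le_trans x0).
have ub N m : expected_mass N m%:R <= geometric_mass N m.
  apply: ler_sum => i _; rewrite ler_wpM2l ?harmonic_ge0// lerD2l lerN2.
  rewrite -mulrN expRM_natl; apply: cM.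
    exact: expR_ge1Dx.
  by rewrite subr_ge0 harmonic_le1.
pose c N m := \sum_(0 <= i < N) (u i * u i.+1 * (1 - (1 - u i.+1) ^+ m)).
have lb N m : geometric_mass N m - 1 + c N m <= expected_mass N m%:R.
  (* Replacing the weight [u i] by [u i.+1] costs [c N m], which tends to 1;
     shifting the index gives it back, as the term of index 0 is at most 1. *)
  have step : geometric_mass N m - 1 <=
      \sum_(0 <= i < N) u i.+1 * (1 - (1 - u i.+1) ^+ m).
    have -> : \sum_(0 <= i < N) u i.+1 * (1 - (1 - u i.+1) ^+ m) =
        geometric_mass N.+1 m - u 0%N * (1 - (1 - u 0%N) ^+ m).
      by rewrite /geometric_mass big_nat_recl//= addrAC subrr add0r.
    apply: lerB.
      rewrite /geometric_mass big_nat_recr//= lerDl mulr_ge0 ?harmonic_ge0//.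
      by rewrite subr_ge0 exprn_ile1 ?subr_ge0 ?harmonic_le1// gerBl harmonic_ge0.
    by rewrite /harmonic/= invr1 mul1r subrr gerBl exprn_ge0.
  apply: (@le_trans _ _ (\sum_(0 <= i < N) u i * (1 - (1 - u i.+1) ^+ m))).
    apply: le_trans (lerD step (lexx _)) _.
    rewrite /c -big_split/=; apply: ler_sum => i _.
    by rewrite -harmonic_subS -mulrDl addrC subrK.
  apply: ler_sum => i _; rewrite ler_wpM2l ?harmonic_ge0// lerD2l lerN2.
  rewrite -mulrN expRM_natl; apply: cM; last exact: expR_ge0.
  have -> : 1 - u i.+1 = (1 + u i)^-1.
    rewrite /harmonic/= -[i.+2%:R]natr1.
    have : (i.+1%:R : R) > 0 by []; move: (i.+1%:R : R) => x x0.
    by field; rewrite ?gt_eqF ?addr_gt0.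
  by rewrite expRN lef_pV2 ?posrE ?expR_gt0 ?expR_ge1Dx// addr_gt0 ?harmonic_gt0.
(* Each power tends to 0, and the remaining series of [u i * u i.+1] has sum 1. This compensates the
   [- 1] in the lower bound [lb]. *)
have cc : c N (n N) @[N --> \oo] --> (1 : R).
  have h : \sum_(0 <= i < N) (u i * u i.+1 * (1 - (1 - u i.+1) ^+ (n N)) - u i * u i.+1)
     @[N --> \oo] --> (0 : R).
    apply: (tannery (f := fun N i => u i * u i.+1 * (1 - (1 - u i.+1) ^+ (n N)))
      _ cvg_series_harmonicMS).
      move=> N i.
      have e0 : 0 <= (1 - u i.+1) ^+ n N by rewrite exprn_ge0// subr_ge0 harmonic_le1.
      have e1 : (1 - u i.+1) ^+ n N <= 1.
        by rewrite exprn_ile1 ?subr_ge0 ?harmonic_le1// gerBl harmonic_ge0.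
      rewrite ger0_norm ?mulr_ge0 ?harmonic_ge0 ?subr_ge0//.
      by rewrite -[leRHS]mulr1 ler_wpM2l ?mulr_ge0 ?harmonic_ge0// gerBl.
    move=> i.
    have y0 : 0 <= 1 - u i.+1 by rewrite subr_ge0 harmonic_le1.
    have y1 : 1 - u i.+1 < 1 by rewrite gtrBl harmonic_gt0.
    have hX : (1 - u i.+1) ^+ m @[m --> \oo] --> (0 : R).
      by apply: cvg_expr; rewrite ger0_norm.
    apply: (cvgn_congr _ (cvgM (cvg_cst (u i * u i.+1))
      (cvgB (cvg_cst (1 : R)) (cvgn_subseq n_infty hX)))) => //.
    by rewrite subr0 mulr1.
  apply: (cvgn_congr _ (cvgD h (cvgB (cvg_cst (1 : R)) (@cvg_harmonic R))))
    => [N|]; last by rewrite subr0 add0r.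
  by rewrite !fctE [X in X + _]sumrB series_harmonicMS subrK.
apply: (squeeze_cvgr (f := fun N =>
  geometric_mass N (n N) - 1 + c N (n N) - ln (n N)%:R)); last exact: cvg_geometric_mass.
  by apply: nearW => N; rewrite !lerD2r ub lb.
apply: (cvgn_congr _ (cvgD cvg_geometric_mass (cvgB cc (cvg_cst (1 : R))))) => [N|].
  by rewrite !fctE; ring.
by rewrite subrr addr0.
Qed.

End limit.

End expected_mass.

(** * Expected mass and variance at times of order [N^theta] *)

Section power_scaling.
Context {R : realType}.
Local Notation u := (@harmonic R).
Local Notation H := (harmonic_number R).

Lemma cvg_powR_nat_infty (s : R) : 0 < s -> N%:R `^ s @[N --> \oo] --> +oo.
Proof.
move=> s0; apply/cvgryPge => M.
pose B := (Num.max M 1) `^ s^-1.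
near=> N.
have BN : B <= N%:R by near: N; exact: nbhs_infty_ger.
have M0 : 0 <= Num.max M 1 by rewrite le_max ler01 orbT.
apply: (@le_trans _ _ (B `^ s)).
  by rewrite /B -powRrM mulVf ?gt_eqF// powRr1// le_max lexx.
by apply: ge0_ler_powR; rewrite ?nnegrE ?powR_ge0// ltW.
Unshelve. all: by end_near. Qed.

Lemma cvg_powR_nat0 (s : R) : 0 < s -> (N%:R `^ s)^-1 @[N --> \oo] --> 0.
Proof.
move=> s0; apply/(gtr0_cvgV0 _); last exact: cvg_powR_nat_infty.
by exists 1%N => // N /= N0; apply: powR_gt0; rewrite ltr0n.
Qed.

Lemma expected_mass_le N (a b : R) : a <= b -> expected_mass N a <= expected_mass N b.
Proof.
move=> ab; apply: ler_sum => i _; rewrite ler_wpM2l ?harmonic_ge0//.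
by rewrite lerD2l lerN2 ler_expR lerN2 ler_wpM2r ?harmonic_ge0.
Qed.

Section approximation.
Variables (theta x : R) (m : nat -> nat).
Hypotheses (theta_gt0 : 0 < theta) (theta_lt1 : theta < 1) (x_gt0 : 0 < x).
Hypothesis m_near : forall N, `|(m N)%:R - x * N%:R `^ theta| <= 1.

Let m_ratio : (m N)%:R / N%:R `^ theta @[N --> \oo] --> x.
Proof.
apply/cvgrPdist_le => e e0.
have /cvgr0Pnorm_le /(_ _ e0) he := cvg_powR_nat0 theta_gt0.
near=> N.
have N0 : 0 < N%:R `^ theta :> R.
  by apply: powR_gt0; rewrite ltr0n; near: N; exact: nbhs_infty_gt.
have -> : x - (m N)%:R / N%:R `^ theta =
    (x * N%:R `^ theta - (m N)%:R) / N%:R `^ theta.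
  by rewrite mulrBl mulfK ?gt_eqF.
rewrite normrM distrC; apply: (@le_trans _ _ (1 * `|(N%:R `^ theta)^-1|)).
  by rewrite ler_wpM2r.
by rewrite mul1r; near: N; exact: he.
Unshelve. all: by end_near. Qed.

Let m_infty : m N @[N --> \oo] --> \oo.
Proof.
suff : (m N)%:R @[N --> \oo] --> (+oo : set_system R) by rewrite cvgrnyP.
apply/cvgryPge => M.
have /cvgryPge /(_ ((M + 1) / x)) h := cvg_powR_nat_infty theta_gt0.
near=> N.
have : (M + 1) / x <= N%:R `^ theta by near: N; exact: h.
rewrite ler_pdivrMr// mulrC => hM.
by have := m_near N; rewrite ler_norml => /andP[h1 _]; lra.
Unshelve. all: by end_near. Qed.

(** Here [theta < 1] enters: the product is at most [x * N^(theta - 1) + u N]. *)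
Let m_small : (m N)%:R * u N @[N --> \oo] --> (0 : R).
Proof.
have h : (x * (N%:R `^ (1 - theta))^-1 + u N) @[N --> \oo] --> (0 : R).
  have t1 : 0 < 1 - theta by rewrite subr_gt0.
  apply: (cvgn_congr _ (cvgD (cvgM (cvg_cst x) (cvg_powR_nat0 t1))
    (@cvg_harmonic R))) => //.
  by rewrite mulr0 addr0.
apply: squeeze_cvgr (cvg_cst _) h.
near=> N; rewrite mulr_ge0 ?harmonic_ge0//=.
have N0 : 0 < N%:R :> R.
  by rewrite ltr0n; near: N; exact: nbhs_infty_gt.
have h1 : (m N)%:R <= x * N%:R `^ theta + 1.
  by have := m_near N; rewrite ler_norml => /andP[_]; rewrite lerBlDl addrC.
apply: le_trans (ler_wpM2r (harmonic_ge0 N) h1) _.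
rewrite mulrDl mul1r lerD2r -mulrA ler_pM2l//.
have -> : (N%:R `^ (1 - theta))^-1 = N%:R `^ theta * N%:R^-1 :> R.
  have e : N%:R = N%:R `^ theta * N%:R `^ (1 - theta) :> R.
    by rewrite -powRD ?subrKC ?powRr1 ?ltW// (gt_eqF N0) implybT.
  by rewrite [X in _ / X]e invfM mulrA divff ?mul1r// gt_eqF// powR_gt0.
rewrite ler_wpM2l ?powR_ge0// /harmonic/= lef_pV2 ?posrE//.
by rewrite ler_nat.
Unshelve. all: by end_near. Qed.

(** Allowing any integer sequence within distance 1 of [x * N^theta] covers both the integer part
    and its successor. *)
Lemma cvg_expected_mass_approx :
  expected_mass N (m N)%:R - theta * H N @[N --> \oo] -->
  ln x + (2 - theta) * euler_gamma R.
Proof.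
have h1 := cvg_expected_mass_nat m_infty m_small.
have h2 : ln ((m N)%:R / N%:R `^ theta) @[N --> \oo] --> ln x.
  by apply: continuous_cvg => //; exact: continuous_ln.
have h3 := @cvg_harmonic_sub_ln R.
have h4 : expected_mass N (m N)%:R - ln (m N)%:R +
    ln ((m N)%:R / N%:R `^ theta) - theta * (H N - ln N%:R) @[N --> \oo] -->
    ln x + (2 - theta) * euler_gamma R.
  apply: (cvgn_congr _ (cvgB (cvgD h1 h2) (cvgM (cvg_cst theta) h3))) => //.
  by ring.
(* Once [N] and [m N] are positive the logarithm of the quotient splits, and the terms in [ln (m N)]
   and in [ln N] cancel. *)
apply: cvg_trans h4; apply: near_eq_cvg; near=> N.
have N0 : 0 < N%:R :> R by rewrite ltr0n; near: N; exact: nbhs_infty_gt.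
have m0 : 0 < (m N)%:R :> R.
  rewrite ltr0n; near: N.
  exact: (m_infty (nbhs_infty_gt 0)).
rewrite ln_div ?posrE ?powR_gt0// ln_powR; ring.
Unshelve. all: by end_near. Qed.

End approximation.

Variables (theta x : R).
Hypotheses (theta_gt0 : 0 < theta) (theta_lt1 : theta < 1) (x_gt0 : 0 < x).

(** [expected_mass] is monotone in the time, hence squeezed between its values at two consecutive
    integers. *)
Lemma cvg_expected_mass :
  expected_mass N (x * N%:R `^ theta) - theta * H N @[N --> \oo] -->
  ln x + (2 - theta) * euler_gamma R.
Proof.
have a0 N : 0 <= x * N%:R `^ theta by rewrite mulr_ge0 ?powR_ge0// ltW.
pose m N := Num.truncn (x * N%:R `^ theta).
have mP N : (m N)%:R <= x * N%:R `^ theta < (m N).+1%:R by exact: truncn_itv.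
apply: (squeeze_cvgr (f := fun N => expected_mass N (m N)%:R - theta * H N)
  (h := fun N => expected_mass N (m N).+1%:R - theta * H N)).
- apply: nearW => N; have /andP[h1 h2] := mP N.
  by rewrite !lerD2r !expected_mass_le// ltW.
- apply: cvg_expected_mass_approx => // N; have /andP[] := mP N.
  by rewrite -natr1 ler_norml => h1 h2; apply/andP; split; lra.
- apply: (cvg_expected_mass_approx (m := fun N => (m N).+1)) => // N; have /andP[] := mP N.
  by rewrite -natr1 ler_norml => h1 h2; apply/andP; split; lra.
Qed.

Lemma cvg_mass_variance :
  \sum_(0 <= i < N) u i ^+ 2 * expR (- (x * N%:R `^ theta * u i)) @[N --> \oo] --> (0 : R).
Proof.
pose f N i := u i ^+ 2 * expR (- (x * N%:R `^ theta * u i)).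
have : \sum_(0 <= i < N) (f N i - 0) @[N --> \oo] --> (0 : R).
  (* The factor 2 comes from [u i <= 2 * u i.+1]. *)
  apply: (tannery (f := f) (l := fun=> 0) (g := fun i => 2 * (u i * u i.+1))).
  - move=> N i; rewrite /f ger0_norm; last by rewrite mulr_ge0 ?expR_ge0 ?sqr_ge0.
    have h : u i <= 2 * u i.+1.
      rewrite /harmonic/= ler_pdivlMr// mulrC ler_pdivrMr// -natrM ler_nat.
      by rewrite mul2n -addnn addSnnS leq_addl.
    apply: (@le_trans _ _ (u i ^+ 2)).
      rewrite ler_piMr ?sqr_ge0// expR_le1 oppr_le0.
      by rewrite !mulr_ge0 ?powR_ge0 ?harmonic_ge0// ltW.
    by rewrite expr2 mulrCA ler_wpM2l ?harmonic_ge0.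
  - exact: (@is_cvg_seriesZ _ _ (2 : R) cvg_series_harmonicMS).
  - move=> i.
    have h : expR (- (x * N%:R `^ theta * u i)) @[N --> \oo] --> (0 : R).
      have h1 : x * N%:R `^ theta * u i @[N --> \oo] --> +oo.
        apply/cvgryPge => M.
        have /cvgryPge /(_ (M / (x * u i))) h := cvg_powR_nat_infty theta_gt0.
        near=> N.
        have : M / (x * u i) <= N%:R `^ theta by near: N; exact: h.
        by rewrite ler_pdivrMr ?mulr_gt0 ?harmonic_gt0// mulrCA mulrA.
      exact: (cvg_comp _ (fun z : R => expR (- z)) h1 (@cvgr_expR R)).
    apply: (cvgn_congr _ (cvgM (cvg_cst (u i ^+ 2)) h)) => //.
    by rewrite mulr0.
move=> h; apply: (cvgn_congr _ h) => // N.
by apply: eq_bigr => i _; rewrite subr0.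
Unshelve. all: by end_near. Qed.

End power_scaling.

(** * Deviation bounds and hitting times *)

Section second_moment.
Context {d : measure_display} {Omega : measurableType d} {R : realType}.
Variable P : probability Omega R.

Lemma integral_indic_comb (I : Type) (s : seq I) (c : I -> R) (B : I -> set Omega) :
  (forall i, measurable (B i)) ->
  (\int[P]_w (\sum_(i <- s) c i * \1_(B i) w)%:E)%E =
  (\sum_(i <- s) c i * fine (P (B i)))%:E.
Proof.
move=> mB.
have iB i : P.-integrable setT (fun w => ((c i)%:E * (\1_(B i) w)%:E)%E).
  exact/integrableZl/integrable_indic.
under eq_integral do rewrite -sumEFin.
rewrite integral_sum//.
rewrite -sumEFin; apply: eq_bigr => i _.
rewrite (_ : (fun w => (c i * \1_(B i) w)%:E) =
  (fun w => ((c i)%:E * (\1_(B i) w)%:E)%E))//.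
rewrite integralZl//; last exact: integrable_indic.
by rewrite integral_indic// setIT EFinM fineK// fin_num_measure.
Qed.

(** Chebyshev's inequality: when the centred sum is squared, pairwise independence kills the cross
    terms and the diagonal leaves the Bernoulli variances. *)
Lemma chebyshev_indic (I : finType) (w : I -> R) (A : I -> set Omega) (eps : R) :
  (forall i, measurable (A i)) ->
  (forall i j, i != j -> P (A i `&` A j) = (P (A i) * P (A j))%E) ->
  0 < eps ->
  (P [set omega | (eps <=
       `|\sum_i w i * \1_(A i) omega - \sum_i w i * fine (P (A i))|)%R ] <=
   (eps ^- 2 * \sum_i w i ^+ 2 * (fine (P (A i)) * (1 - fine (P (A i)))))%:E)%E.
Proof.
move=> mA ind e0.
set S := [set omega | _].
pose p i := fine (P (A i)).
(* The centred sum is again a combination of indicators, the constants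
   [- p i] being carried by the full set; squaring it then only needs the
   probabilities of pairwise intersections. *)
pose c (k : I * bool) : R := w k.1 * (if k.2 then 1 else - p k.1).
pose B (k : I * bool) : set Omega := if k.2 then A k.1 else setT.
have mB k : measurable (B k) by rewrite /B; case: k.2.
pose Y omega := \sum_k c k * \1_(B k) omega.
have YE omega : Y omega = \sum_i w i * \1_(A i) omega - \sum_i w i * fine (P (A i)).
  rewrite -sumrB /Y -(pair_bigA _ (fun i b => c (i, b) * \1_(B (i, b)) omega))/=.
  apply: eq_bigr => i _; rewrite big_bool/= /c /B/= indicT/=.
  by rewrite !mulr1 mulrN.
have mY : measurable_fun setT Y.
  apply: measurable_sum => k; apply: measurable_funM => //.
have SE : S = [set omega | eps <= `|Y omega|].
  by apply/seteqP; split => omega /=; rewrite YE.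
have mS : measurable S.
  rewrite SE -[X in measurable X]setTI.
  have := measurableT_comp (@normr_measurable R setT) mY.
  by move=> /(_ measurableT `[eps, +oo[%classic (measurable_itv _)); rewrite /preimage/=;
    under eq_set do rewrite in_itv/= andbT.
have Y2 : (\int[P]_omega (Y omega ^+ 2)%:E)%E =
    (\sum_i w i ^+ 2 * (p i * (1 - p i)))%:E.
  pose c2 (k : (I * bool) * (I * bool)) := c k.1 * c k.2.
  pose B2 (k : (I * bool) * (I * bool)) := B k.1 `&` B k.2.
  have -> : (fun omega => (Y omega ^+ 2)%:E) =
      (fun omega => (\sum_k c2 k * \1_(B2 k) omega)%:E).
    apply/funext => omega; congr EFin.
    rewrite -(pair_bigA _ (fun k l => c2 (k, l) * \1_(B2 (k, l)) omega))/=.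
    rewrite expr2 /Y mulr_suml; apply: eq_bigr => k _.
    rewrite mulr_sumr; apply: eq_bigr => l _.
    by rewrite /c2 /B2/= indicI /= mulrACA.
  rewrite integral_indic_comb; last by move=> k; exact: measurableI.
  congr EFin.
  rewrite -(pair_bigA _ (fun k l => c2 (k, l) * fine (P (B2 (k, l)))))/=.
  rewrite -(pair_bigA _ (fun i a => \sum_l c2 ((i, a), l) * fine (P (B2 ((i, a), l)))))/=.
  apply: eq_bigr => i _.
  have PE j : fine (P (A i `&` A j)) = if i == j then p i else p i * p j.
    case: eqVneq => [<-|ij]; first by rewrite setIid.
    by rewrite ind// fineM// fin_num_measure.
  (* This is the integral of [Y] against the component [(i, a)]. For [a = false] the component is
     constant and [Y] is centred, so it is 0. For [a = true] only [j = i] survives. *)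
  have inner a : \sum_l c2 ((i, a), l) * fine (P (B2 ((i, a), l))) =
     (if a then w i ^+ 2 * (p i * (1 - p i)) else 0).
    rewrite -(pair_bigA _ (fun j b => c2 ((i, a), (j, b)) * fine (P (B2 ((i, a), (j, b))))))/=.
    have term j : \sum_b c2 ((i, a), (j, b)) * fine (P (B2 ((i, a), (j, b)))) =
        (if a then w i * w j * ((if i == j then p i else p i * p j) - p i * p j)
         else 0).
      rewrite big_bool /c2 /B2 /c /B/=; case: a.
        rewrite PE setIT -[fine (P (A i))]/(p i).
        by move: (if _ then _ else _) => q; ring.
      by rewrite !setTI probability_setT -[fine (P (A j))]/(p j)/=; ring.
    under eq_bigr do rewrite term.
    case: a {term} => /=; last by rewrite big1.
    rewrite (bigD1 i)//= eqxx big1 => [|j ji]; first by rewrite addr0; ring.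
    by rewrite eq_sym (negbTE ji) subrr mulr0.
  by rewrite big_bool/= !inner addr0.
(* Markov's inequality, from [eps ^+ 2 * \1_S <= Y ^+ 2] pointwise. *)
have h : ((eps ^+ 2)%:E * P S <= (\sum_i w i ^+ 2 * (p i * (1 - p i)))%:E)%E.
  rewrite -Y2 -[X in (_ * P X)%E]setIT -integral_indic// -ge0_integralZl//; last 2 first.
  - by apply/measurable_EFinP; exact: measurable_indic.
  - by rewrite lee_fin sqr_ge0.
  apply: ge0_le_integral => //.
  - by move=> omega _; rewrite mule_ge0 ?lee_fin ?sqr_ge0.
  - by apply/measurable_EFinP; apply: measurable_funM => //; exact: measurable_indic.
  - by apply/measurable_EFinP; exact: measurable_funX.
  - move=> omega _; rewrite -EFinM lee_fin indicE.
    case: (boolP (omega \in S)) => [|_]; last by rewrite mulr0 sqr_ge0.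
    rewrite SE inE/= mulr1 => h; rewrite -[leRHS]real_normK ?num_real//.
    by rewrite lerXn2r ?nnegrE// ltW.
rewrite EFinM -lee_pdivrMl ?invr_gt0 ?exprn_gt0//.
by rewrite invrK.
Qed.

End second_moment.

Section exponential_cdf.
Context {R : realType}.

(** The density vanishes on the negative half-line, so only [[0, t]] counts. *)
Lemma exponential_prob_itvNyc (rate t : R) : 0 < rate -> 0 < t ->
  exponential_prob rate `]-oo, t] = (1 - expR (- (rate * t)))%:E.
Proof.
move=> r0 t0.
have -> : `]-oo, t]%classic = `]-oo, 0[ `|` `[0, t] :> set R.
  apply/seteqP; split => x /=; rewrite !in_itv/=.
    by move=> xt; have [x0|x0] := ltP x 0; [left|right; rewrite xt].
  by case=> [x0|/andP[]//]; rewrite ltW// (lt_trans x0).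
rewrite /exponential_prob ge0_integral_setU//=; last 3 first.
- apply/measurable_EFinP/measurable_funTS; exact: measurable_exponential_pdf.
- by move=> x _; rewrite lee_fin exponential_pdf_ge0// ltW.
- apply/disj_set2P; rewrite -subset0 => x [] /=; rewrite !in_itv/= => x0 /andP[x0' _].
  by move: (lt_le_trans x0 x0'); rewrite ltxx.
rewrite integral0_eq ?add0e => [|x /=]; last first.
  by rewrite in_itv/= => x0; rewrite lt0_exponential_pdf.
by have := exponential_prob_itv0c rate t0; rewrite /exponential_prob mulNr => ->.
Qed.

End exponential_cdf.

Section quorum.
Context {R : realType} {d : measure_display} {Omega : measurableType d} {N : nat}.
Variables (w : 'I_N -> R) (T : 'I_N -> Omega -> R) (theta : R).
Hypothesis w_ge0 : forall i, 0 <= w i.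
Hypothesis mT : forall i, measurable_fun setT (T i).

Lemma discovered_mass_le omega (s t : R) : s <= t ->
  discovered_mass w T s omega <= discovered_mass w T t omega.
Proof.
move=> st; apply: ler_sum => i _; rewrite ler_wpM2l// !indicE.
rewrite ler_nat; case: (boolP (omega \in [set omega' | T i omega' <= s])) => //.
by rewrite !inE/= => h; rewrite mem_set//= (le_trans h).
Qed.

Lemma measurable_discovered_le i t : measurable [set omega | T i omega <= t].
Proof.
have /(_ measurableT _ (measurable_itv `]-oo, t])) := mT i.
rewrite setTI.
by rewrite (_ : T i @^-1` _ = [set omega | T i omega <= t]).
Qed.

Lemma measurable_discovered_mass t : measurable_fun setT (discovered_mass w T t).
Proof.
apply: measurable_sum => i; apply: measurable_funM => //.
exact/measurable_indic/measurable_discovered_le.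
Qed.

(** Some witness lies strictly before [t], and the mass only grows from there. Together with
    [quorum_time_gt] this turns strict inequalities on the time into inequalities on the mass,
    whether or not the infimum is attained. *)
Lemma quorum_time_lt omega (t : R) : (quorum_time w T theta omega < t%:E)%E ->
  theta < discovered_mass w T t omega.
Proof.
move=> /ereal_inf_lt[_ [s [s0 hs] <-]]; rewrite lte_fin => st.
by apply: lt_le_trans hs _; rewrite discovered_mass_le// ltW.
Qed.

Lemma quorum_time_gt omega (t : R) : 0 <= t -> (t%:E < quorum_time w T theta omega)%E ->
  discovered_mass w T t omega <= theta.
Proof.
move=> t0; apply: contraTT; rewrite -ltNge -leNgt => h.
by apply: ereal_inf_lbound; exists t.
Qed.

(** Used when monotonicity of the probability is applied to the deviation event of the quorum
    time. *)
Lemma measurable_quorum_time : measurable_fun setT (quorum_time w T theta).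
Proof.
apply: (measurability _ (ErealGenInftyO.measurableE R)) => _ /= -[_ [t ->] <-].
rewrite setTI.
(* The mass is nondecreasing, so a witness before [t] can be taken among the
   times [t - 1/(n+1)]. *)
have -> : quorum_time w T theta @^-1` `]-oo, t%:E[%classic =
    \bigcup_n [set omega | 0 <= t - n.+1%:R^-1 /\
      theta < discovered_mass w T (t - n.+1%:R^-1) omega].
  apply/seteqP; split => omega /=.
    rewrite in_itv/= => /ereal_inf_lt[_ [s [s0 hs] <-]]; rewrite lte_fin => st.
    have ts : 0 < t - s by rewrite subr_gt0.
    have /cvgr0Pnorm_lt /(_ _ ts) [n _ /(_ n (leqnn n))] := @cvg_harmonic R.
    rewrite ger0_norm ?harmonic_ge0// /harmonic/= => hn.
    have sn : s <= t - n.+1%:R^-1 by rewrite lerBrDr -lerBrDl ltW.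
    exists n => //=; split; first exact: le_trans sn.
    by apply: lt_le_trans hs _; exact: discovered_mass_le.
  move=> [n _ /= [h0 h]]; rewrite in_itv/=.
  apply: (@le_lt_trans _ _ (t - n.+1%:R^-1)%:E).
    by apply: ereal_inf_lbound; exists (t - n.+1%:R^-1).
  by rewrite lte_fin gtrBl invr_gt0.
apply: bigcupT_measurable => n.
have [h|h] := boolP (0 <= t - n.+1%:R^-1); last first.
  by rewrite (_ : [set _ | _] = set0)// -subset0 => omega /= [].
have /(_ measurableT _ (measurable_itv `]theta, +oo[)) :=
  measurable_discovered_mass (t - n.+1%:R^-1).
rewrite setTI; congr measurable; apply/seteqP; split => omega /=.
  by rewrite in_itv/= andbT.
by rewrite in_itv/= andbT => -[].
Qed.

End quorum.

(** Passing to a smaller [eps'] lets the caller keep the lower time positive. The value [+oo] falls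
    in the right alternative. *)
Lemma ereal_dist_gt {R : realType} (y : \bar R) (K l eps eps' : R) :
  0 < K -> eps' <= eps -> (eps%:E < `|y * (K^-1)%:E - l%:E|)%E ->
  (y < ((l - eps') * K)%:E)%E \/ (((l + eps') * K)%:E < y)%E.
Proof.
move=> K0 ee; case: y => [y| |] /=; [|by right; rewrite ltry|by left; rewrite ltNyr].
rewrite !lte_fin => h.
have : eps' < `|y / K - l| by exact: le_lt_trans h.
rewrite ltNge ler_norml negb_and -!ltNge => /orP[h1|h1]; [left|right].
  by rewrite -ltr_pdivrMr//; lra.
by rewrite -ltr_pdivlMr//; lra.
Qed.

(** * Concentration of the discovered mass in the Zipf model *)

Section zipf_model.
Context {R : realType} (lambda theta : R).
Hypotheses (lambda_gt0 : 0 < lambda) (theta_gt0 : 0 < theta) (theta_lt1 : theta < 1).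
Context (d : nat -> measure_display) (Omega : forall N : nat, measurableType (d N)).
Variables (P : forall N : nat, probability (Omega N) R).
Variable (T : forall N : nat, 'I_N -> {RV (P N) >-> R}).
Arguments T : clear implicits.
Hypothesis T_indep : forall N : nat, independent_RVs (T N).
Hypothesis T_exp : forall (N : nat) (i : 'I_N),
  exponentially_distributed (T N i) (lambda * zipf R i).
Local Notation H := (harmonic_number R).
Local Notation u := (@harmonic R).

Definition zipf_time (x : R) N := x / lambda * (H N * N%:R `^ theta).

Definition zipf_mass (x : R) N : Omega N -> R :=
  discovered_mass (@zipf R N) (fun i => T N i) (zipf_time x N).

Local Notation M x N := (@zipf_mass x N).

Lemma harmonic_number_gt0 N : (0 < N)%N -> 0 < H N.
Proof.
case: N => // N _; rewrite harmonic_numberE big_nat_recr//= ltr_wpDl ?harmonic_gt0//.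
by apply: sumr_ge0 => i _; rewrite harmonic_ge0.
Qed.

Lemma zipf_ge0 N (i : 'I_N) : 0 <= zipf R i.
Proof.
rewrite /zipf invr_ge0 mulr_ge0// harmonic_numberE.
by apply: sumr_ge0 => k _; rewrite harmonic_ge0.
Qed.

Lemma measurable_deviation (x m delta : R) N :
  measurable [set omega | delta <= `|H N * M x N omega - m|].
Proof.
have mM : measurable_fun setT (fun omega => `|H N * M x N omega - m|).
  apply: measurableT_comp => //; apply: measurable_funB => //.
  by apply: measurable_funM => //; apply: measurable_discovered_mass.
have /(_ measurableT _ (measurable_itv `[delta, +oo[)) := mM.
rewrite setTI; congr measurable; apply/seteqP; split => omega /=;
  by rewrite in_itv/= andbT.
Qed.

(** Multiplying by [H N] turns the weights into [u i], and [zipf_time] makes rate times time equal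
    to [x * N^theta * u i]. The Bernoulli variance [p (1 - p)] is bounded by [1 - p], which is the
    exponential. *)
Lemma mass_deviation_le (x delta : R) N : 0 < x -> (0 < N)%N -> 0 < delta ->
  (P N [set omega | (delta <=
     `|H N * M x N omega - expected_mass N (x * N%:R `^ theta)|)%R] <=
   (delta ^- 2 * \sum_(0 <= i < N) u i ^+ 2 * expR (- (x * N%:R `^ theta * u i)))%:E)%E.
Proof.
move=> x0 N0 delta0.
have H0 := harmonic_number_gt0 N0.
have N0' : 0 < N%:R `^ theta :> R by rewrite powR_gt0 ?ltr0n.
have t0 : 0 < zipf_time x N by rewrite /zipf_time mulr_gt0 ?divr_gt0// mulr_gt0.
pose A (i : 'I_N) := [set omega | T N i omega <= zipf_time x N].
have AE i : A i = T N i @^-1` `]-oo, zipf_time x N] by [].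
have mA i : measurable (A i).
  exact: (measurable_discovered_le (T := fun j => T N j : Omega N -> R)).
have zE (i : 'I_N) : zipf R i = u i / H N by rewrite /zipf /harmonic/= invfM.
have PA i : P N (A i) = (1 - expR (- (x * N%:R `^ theta * u i)))%:E.
  rewrite AE; have := T_exp i (measurable_itv `]-oo, zipf_time x N]).
  rewrite /distribution/= /pushforward => ->.
  rewrite exponential_prob_itvNyc//; last by rewrite zE mulr_gt0 ?divr_gt0 ?harmonic_gt0.
  suff -> : lambda * zipf R i * zipf_time x N = x * N%:R `^ theta * u i by [].
  rewrite zE /zipf_time; move: (u i) (H N) H0 => v h h0.
  by field; rewrite !gt_eqF.
have ind i j : i != j -> P N (A i `&` A j) = (P N (A i) * P N (A j))%E.
  move=> ij; have := @T_indep N [set i; j]%SET (fun=> `]-oo, zipf_time x N]%classic).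
  rewrite big_setU1 ?inE// big_set1 !AE => <- //.
  congr (P N _); apply/seteqP; split => omega /=.
    by move=> [hi hj] k /=; rewrite !inE => /orP[] /eqP ->.
  by move=> h; split; apply: h; rewrite /= !inE eqxx ?orbT.
have := chebyshev_indic (fun i : 'I_N => u i) mA ind delta0.
have -> : \sum_(i < N) u i * fine (P N (A i)) = expected_mass N (x * N%:R `^ theta).
  by rewrite /expected_mass big_mkord; apply: eq_bigr => i _; rewrite PA.
have ME omega : H N * M x N omega = \sum_(i < N) u i * \1_(A i) omega.
  rewrite /zipf_mass /discovered_mass mulr_sumr; apply: eq_bigr => i _.
  by rewrite mulrA zE mulrCA divff ?mulr1// gt_eqF.
under [X in (_ -> (P N X <= _)%E)]eq_set do rewrite ME.
move=> /le_trans; apply; rewrite lee_fin ler_wpM2l ?invr_ge0 ?sqr_ge0//.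
rewrite big_mkord; apply: ler_sum => i _; rewrite ler_wpM2l ?sqr_ge0//.
by rewrite PA/= subKr ler_piMl ?expR_ge0// gerBl expR_ge0.
Qed.

Lemma cvg_mass_deviation (x delta : R) : 0 < x -> 0 < delta ->
  P N [set omega | (delta <=
     `|H N * M x N omega - expected_mass N (x * N%:R `^ theta)|)%R] @[N --> \oo] --> 0%E.
Proof.
move=> x0 delta0.
pose V N : R := delta ^- 2 *
  \sum_(0 <= i < N) u i ^+ 2 * expR (- (x * N%:R `^ theta * u i)).
have hV : (V N)%:E @[N --> \oo] --> 0%E.
  apply: cvg_EFin; first exact: nearW.
  apply: (cvgn_congr _ (cvgM (cvg_cst (delta ^- 2))
    (cvg_mass_variance theta_gt0 x0))) => //.
  by rewrite mulr0.
apply: squeeze_cvge (cvg_cst 0%E) hV.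
near=> N; rewrite measure_ge0/= mass_deviation_le//.
by near: N; exact: nbhs_infty_gt.
Unshelve. all: by end_near. Qed.

(** The limit [L] of [expected_mass - theta * H N] equals [ln x - ln (c_ theta) > 0]. Eventually the
    gap exceeds [L / 2], while a late quorum means [H N * M x N <= theta * H N]. *)
Lemma deviation_of_late_quorum (x : R) : c_ theta < x ->
  exists2 delta, 0 < delta & \forall N \near \oo, forall omega,
    M x N omega <= theta ->
    delta <= `|H N * M x N omega - expected_mass N (x * N%:R `^ theta)|.
Proof.
move=> cx; have c0 : 0 < c_ theta by exact: expR_gt0.
have x0 := lt_trans c0 cx.
pose L := ln x + (2 - theta) * euler_gamma R.
have L0 : 0 < L.
  have : ln (c_ theta) < ln x by rewrite ltr_ln ?posrE.
  by rewrite /c_ expRK /L -opprB mulNr; lra.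
exists (L / 2); first by rewrite divr_gt0.
have L2 : L / 2 < L by lra.
have /cvgr_gt /(_ _ L2) h := cvg_expected_mass theta_gt0 theta_lt1 x0.
near=> N => omega hM.
have N0 : (0 < N)%N by near: N; exact: nbhs_infty_gt.
have hN : L / 2 < expected_mass N (x * N%:R `^ theta) - theta * H N by near: N; exact: h.
have hHM : H N * M x N omega <= theta * H N.
  by rewrite mulrC ler_wpM2r// ltW// harmonic_number_gt0.
by rewrite distrC; apply: le_trans (ler_norm _); lra.
Unshelve. all: by end_near. Qed.

Lemma deviation_of_early_quorum (x : R) : 0 < x -> x < c_ theta ->
  exists2 delta, 0 < delta & \forall N \near \oo, forall omega,
    theta < M x N omega ->
    delta <= `|H N * M x N omega - expected_mass N (x * N%:R `^ theta)|.
Proof.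
move=> x0 xc; have c0 : 0 < c_ theta by exact: expR_gt0.
pose L := ln x + (2 - theta) * euler_gamma R.
have L0 : L < 0.
  have : ln x < ln (c_ theta) by rewrite ltr_ln ?posrE.
  by rewrite /c_ expRK /L -opprB mulNr; lra.
exists (- L / 2); first by rewrite divr_gt0// oppr_gt0.
have L2 : L < L / 2 by lra.
have /cvgr_lt /(_ _ L2) h := cvg_expected_mass theta_gt0 theta_lt1 x0.
near=> N => omega hM.
have N0 : (0 < N)%N by near: N; exact: nbhs_infty_gt.
have hN : expected_mass N (x * N%:R `^ theta) - theta * H N < L / 2 by near: N; exact: h.
have hHM : theta * H N <= H N * M x N omega.
  by rewrite [leRHS]mulrC ler_wpM2r// ltW// harmonic_number_gt0.
by apply: le_trans (ler_norm _); lra.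
Unshelve. all: by end_near. Qed.

End zipf_model.

(** * Convergence in probability of the quorum time *)

Unset Implicit Arguments.
Set Strict Implicit.

Theorem theorem6p3 (R : realType) (lambda theta : R)
    (lambda_gt0 : 0 < lambda) (theta_gt0 : 0 < theta) (theta_lt1 : theta < 1)
    (d : nat -> measure_display)
    (Omega : forall N : nat, measurableType (d N))
    (P : forall N : nat, probability (Omega N) R)
    (T : forall N : nat, 'I_N -> {RV (P N) >-> R})
    (T_indep : forall N : nat, independent_RVs (T N))
    (T_exp : forall (N : nat) (i : 'I_N),
       exponentially_distributed (T N i) (lambda * zipf R i)) :
  cvg_in_probability P
    (fun N omega =>
       quorum_time (@zipf R N) (fun i => T N i : Omega N -> R) theta omega
         * ((harmonic_number R N * N%:R `^ theta)^-1)%:E)%E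
    (c_ theta / lambda).
Proof.
pose M x N := @zipf_mass R lambda theta d Omega P T x N.
move=> eps eps0.
have c0 : 0 < c_ theta by exact: expR_gt0.
(* Capping at half of the limit keeps [x1] positive, so that the deviation bound applies at the
   lower time. *)
pose eps' := Num.min eps (c_ theta / lambda / 2).
have e'0 : 0 < eps' by rewrite lt_min eps0 !divr_gt0.
have ee : eps' <= eps by rewrite ge_min lexx.
have el : lambda * eps' < c_ theta.
  rewrite -ltr_pdivlMl// mulrC.
  apply: (@le_lt_trans _ _ (c_ theta / lambda / 2)); first by rewrite ge_min lexx orbT.
  have : 0 < c_ theta / lambda by rewrite divr_gt0.
  lra.
pose x1 := c_ theta - lambda * eps'; pose x2 := c_ theta + lambda * eps'.
have x10 : 0 < x1 by rewrite subr_gt0.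
have x20 : 0 < x2 by rewrite addr_gt0// mulr_gt0.
have x1c : x1 < c_ theta by rewrite gtrBl mulr_gt0.
have x2c : c_ theta < x2 by rewrite ltrDl mulr_gt0.
have [d1 d10 h1] := deviation_of_early_quorum lambda theta_gt0 theta_lt1 T x10 x1c.
have [d2 d20 h2] := deviation_of_late_quorum lambda theta_gt0 theta_lt1 T x2c.
pose D x delta N := [set omega | (delta <=
     `|harmonic_number R N * M x N omega - expected_mass N (x * N%:R `^ theta)|)%R].
have hD : (P N (D x1 d1 N) + P N (D x2 d2 N))%E @[N --> \oo] --> 0%E.
  rewrite -[X in _ --> X]adde0; apply: cvgeD => //; exact: cvg_mass_deviation.
apply: squeeze_cvge (cvg_cst 0%E) hD.
near=> N; rewrite measure_ge0/=.
have N0 : (0 < N)%N by near: N; exact: nbhs_infty_gt.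
have K0 : 0 < harmonic_number R N * N%:R `^ theta.
  by rewrite mulr_gt0 ?harmonic_number_gt0// powR_gt0// ltr0n.
have mD x delta : measurable (D x delta N) by exact: measurable_deviation.
(* A quorum too early forces a mass deviation at [x1], one too late forces a deviation at [x2]. *)
apply: (@le_trans _ _ (P N (D x1 d1 N `|` D x2 d2 N))); last exact: measureU2.
apply: le_measure; rewrite ?inE; [| exact: measurableU |].
- rewrite -[X in measurable X]setTI.
  apply: emeasurable_fun_o_infty => //.
  apply: (measurableT_comp (@abse_measurable R setT)).
  apply: emeasurable_funD => //.
  by apply: emeasurable_funM => //; apply: measurable_quorum_time => // i; exact: zipf_ge0.
- move=> omega /= /(ereal_dist_gt K0 ee) [h|h]; [left|right].
  + have h' : forall omega, theta < M x1 N omega -> D x1 d1 N omega by near: N.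
    apply: h'; apply: quorum_time_lt => [i|]; first exact: zipf_ge0.
    rewrite /zipf_time (_ : x1 / lambda = c_ theta / lambda - eps')//.
    by rewrite /x1 mulrBl [lambda * _]mulrC mulfK ?gt_eqF.
  + have h' : forall omega, M x2 N omega <= theta -> D x2 d2 N omega by near: N.
    apply: h'; apply: quorum_time_gt.
      by rewrite /zipf_time mulr_ge0 ?divr_ge0// ltW.
    rewrite /zipf_time (_ : x2 / lambda = c_ theta / lambda + eps')//.
    by rewrite /x2 mulrDl [lambda * _]mulrC mulfK ?gt_eqF.
Unshelve. all: by end_near. Qed.
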